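(* Suppose that $(X,d)$ is a homogeneous metric space and $\mu$ is an invariant measure on $X$. Then the quantity $\int_{x\in X} e^{-d(x,y)}\,d\mu(x)$ is independent of $y\in X$. If this quantity is non-zero and finite, then a weight measure on $X$ is given by $$\frac{\mu}{\int_{x\in X}e^{-d(x,y)}\,d\mu(x)}.$$ Thus the magnitude of $X$ is given by $$|X|=\frac{\int_{x\in X}d\mu(x)}{\int_{x\in X}e^{-d(x,y)}\,d\mu(x)}.$$
   Context: A metric space $X$ is homogeneous if there is a group of isometries of $X$ acting transitively on $X$; a measure on $X$ is invariant if it is preserved by the elements of such a transitive group of isometries. A weight measure on a metric space $(X,d)$ is a finite signed Borel measure $\nu$ on $X$ such that $\int_{x\in X}e^{-d(x,y)}\,d\nu(x)=1$ for all $y\in X$. If a weight measure $\nu$ exists on $X$, the magnitude of $X$ is defined to be the mass of $X$ with respect to $\nu$, that is $|X|:=\int_X d\nu$ (which does not depend on the choice of weight measure).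
   Formalization: The weight-measure and magnitude claims assume μ(X) is finite (Lebesgue measure on ℝ fails otherwise); X is non-empty; the magnitude is the mass of some weight measure, with independence of the choice of weight measure proved only for separable X. *)

(* Defs.v *)
From HB Require Import structures.
From mathcomp Require Import all_boot all_order all_algebra.
From mathcomp Require Import all_classical all_reals all_analysis.

Set Implicit Arguments.
Unset Strict Implicit.
Unset Printing Implicit Defensive.

Import Order.TTheory GRing.Theory Num.Theory.
Import numFieldNormedType.Exports.

Local Open Scope classical_set_scope.
Local Open Scope ring_scope.

(* Nonempty metric spaces: [g_sigma_algebraType] asks for a base point. *)
#[short(type="pmetricType")]
HB.structure Definition PointedMetric (R : numDomainType) :=
  {M of Metric R M & Pointed M}.

Notation borel X := (g_sigma_algebraType (@open X)).

Section homogeneous.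
Context {R : realType} {X : pmetricType R}.

(* The elements of [G] are surjective, hence isometries in the strong sense,
   because [G] is closed under inverses. *)
Definition isometry_group (G : set (X -> X)) : Prop :=
  [/\ forall g, G g -> forall x y, mdist (g x) (g y) = mdist x y,
      G id,
      forall g h, G g -> G h -> G (g \o h) &
      forall g, G g -> exists2 h, G h & cancel g h /\ cancel h g].

Definition transitive_on (G : set (X -> X)) : Prop :=
  forall x y : X, exists2 g, G g & g x = y.

Definition invariant_measure (mu : {measure set (borel X) -> \bar R}) : Prop :=
  exists G : set (X -> X), [/\ isometry_group G, transitive_on G &
    forall g, G g -> forall A : set (borel X), measurable A ->
      pushforward mu (g : borel X -> borel X) A = mu A].

End homogeneous.

Definition homogeneous (R : realType) (X : pmetricType R) : Prop :=
  exists2 G : set (X -> X), isometry_group G & transitive_on G.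

(* The integral against a charge is the difference of the integrals against
   the two parts of its Jordan decomposition, which does not depend on the
   Hahn decomposition selected here. *)
Section charge_integral.
Context d (T : measurableType d) (R : realType).
Variable nu : {charge set T -> \bar R}.

Definition hahn_pos : set T := sval (cid (Hahn_decomposition nu)).

Definition hahn_neg : set T := sval (cid (svalP (cid (Hahn_decomposition nu)))).

Lemma hahn_pos_neg : hahn_decomposition nu hahn_pos hahn_neg.
Proof. exact: svalP (cid (svalP (cid (Hahn_decomposition nu)))). Qed.

Definition charge_integral (f : T -> \bar R) : \bar R :=
  (\int[jordan_pos hahn_pos_neg]_x f x - \int[jordan_neg hahn_pos_neg]_x f x)%E.

End charge_integral.

Section magnitude.
Context {R : realType} (X : pmetricType R).

(* A charge takes finite values on measurable sets: charges on [borel X] are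
   the finite signed Borel measures on [X]. *)
Definition weight_measure (nu : {charge set (borel X) -> \bar R}) : Prop :=
  forall y : X,
    charge_integral nu (fun x : borel X => (expR (- mdist (x : X) y))%:E) = 1%E.

Definition is_magnitude (m : \bar R) : Prop :=
  exists2 nu : {charge set (borel X) -> \bar R},
    weight_measure nu & m = nu setT.

(* Junk value [0] if [X] has no weight measure. Two weight measures have the
   same mass by Fubini's theorem for the kernel [expR (- mdist x y)]; this
   needs the kernel to be measurable for the product of the Borel
   sigma-algebras, which holds as soon as [X] is separable. *)
Definition magnitude : \bar R := xget 0%E [set m | is_magnitude m].

Definition separable : Prop := exists2 S : set X, countable S & dense S.

End magnitude.

(* Main.v *)
Require Import Defs.
From HB Require Import structures.
From mathcomp Require Import all_boot all_order all_algebra.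
From mathcomp Require Import all_classical all_reals all_analysis.
From mathcomp Require Import measurable_realfun.
From mathcomp Require Import ring lra.

Set Implicit Arguments.
Unset Strict Implicit.
Unset Printing Implicit Defensive.

Import Order.TTheory GRing.Theory Num.Theory.
Import numFieldNormedType.Exports.
Import metricType_numDomainType.

Local Open Scope classical_set_scope.
Local Open Scope ring_scope.
Local Open Scope ereal_scope.

(** Write [k (x, y) = expR (- mdist x y)].  If a transitive group [G] of
    isometries preserves [mu], choose [g] in [G] with [g y = z]; transporting
    the integral of [k (x, z)] along [g] replaces [mdist (g x) (g y)] by
    [mdist x y] and leaves [mu] unchanged, so the integral at [z] is the
    integral at [y] ([invariant_radial_integral]).  Call the common value [c].
    When [0 < c < +oo], the measure [c^-1 mu] integrates every [k (x, z)] to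
    [1].  If moreover [mu] has finite mass, [c^-1 mu] is a charge
    ([finite_measure_charge]) whose Jordan decomposition is trivial, so its
    integral as a charge is its integral as a measure
    ([charge_integral_measure]); hence it is a weight measure.

    That the magnitude is the mass of this weight measure requires all weight
    measures to have the same mass.  For a bounded symmetric kernel [k], two
    weight measures [nu] and [nu'] satisfy
      [nu(X) = \int \int k d(nu') d(nu) = \int \int k d(nu) d(nu') = nu'(X)]
    by Fubini's theorem ([weight_mass_unique]).  Fubini's theorem needs [k] to
    be measurable for the product of the two Borel sigma-algebras, which may be
    smaller than the Borel sigma-algebra of the product.  Separability settles
    this: with [S] countable and dense, [mdist x y < r] holds if and only if
    [mdist x s + mdist y s < r] for some [s] in [S] ([measurable_mdist]). *)

(** * Measurability of the distance *)

Lemma measurable_fun_sublevel d (T : measurableType d) (R : realType)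
    (f : T -> R) :
  (forall r, measurable [set x | (f x < r)%R]) -> measurable_fun setT f.
Proof.
move=> mf.
apply: (measurability _ (RGenInftyO.measurableE R)) => _ [_ [r ->] <-].
by rewrite setTI (_ : _ @^-1` _ = [set x | (f x < r)%R]).
Qed.

Section borel_metric.
Context {R : realType} {X : pmetricType R}.
Implicit Types (x y : X).

Lemma measurable_isometry (g : X -> X) :
  (forall x y, mdist (g x) (g y) = mdist x y) ->
  measurable_fun setT (g : borel X -> borel X).
Proof.
move=> isog.
apply: (@measurability _ _ (borel X) (borel X) setT g open erefl) => _ [U oU <-].
rewrite setTI; apply: sub_gen_smallest => /=.
rewrite openE => x /= Ugx.
have /nbhs_mdistP[e /= e0 eU] : nbhs (g x) U by apply: open_nbhs_nbhs.
by apply/nbhs_mdistP; exists e => //= y xy; apply: eU; rewrite /= isog.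
Qed.

Lemma open_mdist_lt y r : open [set x | (mdist x y < r)%R].
Proof.
rewrite openE => x /= xyr; apply/nbhs_mdistP.
exists (r - mdist x y)%R; first by rewrite /= subr_gt0.
move=> z /= xz; rewrite (le_lt_trans (metric_triangle z x y))// metric_sym.
by rewrite -ltrBrDr.
Qed.

Lemma measurable_mdist_left y :
  measurable_fun setT (fun x : borel X => mdist (x : X) y).
Proof.
apply: measurable_fun_sublevel => r; apply: sub_gen_smallest.
exact: open_mdist_lt.
Qed.

(** Joint continuity of the distance only gives measurability for the Borel
    sigma-algebra of the product.  Passing through the points [s] of a countable
    dense set writes each sublevel set as a countable union of sublevel sets of
    functions [mdist z.1 s + mdist z.2 s], in which the coordinates are
    separated. *)
Lemma measurable_mdist : separable X ->
  measurable_fun setT (fun z : borel X * borel X => mdist (z.1 : X) z.2).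
Proof.
move=> [S countS denseS]; apply: measurable_fun_sublevel => r.
rewrite [X in measurable X](_ : _ = \bigcup_(s in S)
    [set z : borel X * borel X | (mdist (z.1 : X) s + mdist (z.2 : X) s < r)%R]).
  rewrite bigcup_set_type; apply: countable_bigcupT_measurable => [|[s Ss]/=].
    by rewrite (eq_countable (card_setT S)).
  have ms : measurable_fun setT
      (fun z : borel X * borel X => mdist (z.1 : X) s + mdist (z.2 : X) s)%R.
    apply: measurable_funD.
      exact: (measurableT_comp (measurable_mdist_left s) measurable_fst).
    exact: (measurableT_comp (measurable_mdist_left s) measurable_snd).
  rewrite [X in measurable X](_ : _ = setT `&`
    (fun z : borel X * borel X => mdist (z.1 : X) s + mdist (z.2 : X) s)%R
      @^-1` `]-oo, r[%classic).
    exact: ms.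
  by rewrite setTI; apply/seteqP; split => z; rewrite /= in_itv.
apply/seteqP; split => [[x y]/= xyr|[x y] [s _]/=]; last first.
  by apply: le_lt_trans; rewrite (metric_sym y); exact: metric_triangle.
(* Going through an [s] at distance less than [e] of [x] costs less than
   [2 * e], the room left between [mdist x y] and [r]. *)
pose e := ((r - mdist (x : X) y) / 2)%R.
have e0 : (0 < e)%R by rewrite divr_gt0// subr_gt0.
have [|s [/= sx Ss]] := denseS [set s | (mdist s x < e)%R] _ (open_mdist_lt _ _).
  by exists x; rewrite /= mdistxx.
exists s => //=; have := metric_triangle y x s.
rewrite (metric_sym y x) (metric_sym x s).
move: sx; rewrite /e; lra.
Qed.

End borel_metric.

(** * Charges that come from measures *)

Section charges.
Context d (T : measurableType d) (R : realType).

Lemma jordan_decompB (nu : {charge set T -> \bar R}) P N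
    (nuPN : hahn_decomposition nu P N) (A : set T) :
  measurable A -> nu A = jordan_pos nuPN A - jordan_neg nuPN A.
Proof. by move=> mA; rewrite {1}(jordan_decomp nuPN mA) /cadd/= cscaleN1. Qed.

(** A charge that agrees with a measure is nonnegative on the negative part of
    its Hahn decomposition, where it is also nonpositive: the negative Jordan
    part vanishes, and the positive one is the measure. *)
Lemma charge_integral_measure (nu : {charge set T -> \bar R})
    (mu : {measure set T -> \bar R}) (f : T -> \bar R) :
  (forall A, measurable A -> nu A = mu A) ->
  charge_integral nu f = \int[mu]_x f x.
Proof.
move=> numu; rewrite /charge_integral.
have [_ [mN Nneg] _ _] := hahn_pos_neg nu.
have negE A : measurable A -> jordan_neg (hahn_pos_neg nu) A = 0.
  move=> mA; rewrite jordan_negE cjordan_negE /crestr0 mem_set// /crestr.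
  have mAN : measurable (A `&` hahn_neg nu) by exact: measurableI.
  apply/eqP; rewrite oppe_eq0 eq_le Nneg//=.
  by rewrite [leRHS]numu.
have -> : \int[jordan_neg (hahn_pos_neg nu)]_x f x = 0.
  rewrite (eq_measure_integral mzero); first exact: integral_measure_zero.
  by move=> A mA _; exact: negE.
rewrite sube0; apply: eq_measure_integral => A mA _.
by rewrite -numu// (jordan_decompB (hahn_pos_neg nu) mA) negE// sube0.
Qed.

End charges.

(** The equality holds on every set, measurable or not: the charge and the
    measure are the same set function. *)
Lemma finite_measure_charge d (T : measurableType d) (R : realType)
    (mu : {measure set T -> \bar R}) : mu setT < +oo ->
  exists nu : {charge set T -> \bar R}, forall A, nu A = mu A.
Proof.
move=> mufin.
(* Restricting to the whole space turns the bound on the total mass into the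
   structure of a finite measure. *)
exists (charge_of_finite_measure (mfrestr measurableT mufin)) => A.
by rewrite -[in RHS](setIT A).
Qed.

(** * Uniqueness of the mass of a weight *)

Section kernel_weights.
Context d (T : measurableType d) (R : realType) (k : T * T -> R) (M : R).
Hypothesis mk : measurable_fun setT k.
Hypothesis k_ge0 : forall z, (0 <= k z)%R.
Hypothesis k_le : forall z, (k z <= M)%R.
Hypothesis k_sym : forall x y, k (x, y) = k (y, x).

Implicit Types m p n : {finite_measure set T -> \bar R}.

Let potential m (y : T) : \bar R := \int[m]_x (k (x, y))%:E.

Let measurable_kernel_fix y : measurable_fun setT (fun x => (k (x, y))%:E).
Proof. by apply/measurable_EFinP; apply: measurableT_comp. Qed.

Let potential_ge0 m y : 0 <= potential m y.
Proof. by apply: integral_ge0 => x _; rewrite lee_fin. Qed.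

Let measurable_potential m : measurable_fun setT (potential m).
Proof.
apply: (@measurable_fun_fubini_tonelli_G _ _ _ _ _ m (EFin \o k)).
  exact/measurable_EFinP.
by move=> z; rewrite lee_fin.
Qed.

Let potential_le m y : potential m y <= (M * fine (m setT))%:E.
Proof.
rewrite EFinM fineK ?fin_num_measure// -integral_cst//.
by apply: ge0_le_integral => //= x _; rewrite lee_fin// (le_trans (k_ge0 (x, y))).
Qed.

Let integrable_potential p m : p.-integrable setT (potential m).
Proof.
apply: le_integrable (finite_measure_integrable_cst p (M * fine (m setT)) measurableT) => // y _.
rewrite gee0_abs// (le_trans (potential_le m y))// lee_fin.
exact: ler_norm.
Qed.

Let energy m p : \bar R := \int[m]_y potential p y.

Let energy_fin m p : energy m p \is a fin_num.
Proof. exact: (integrable_fin_num measurableT (integrable_potential m p)). Qed.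

Let energy_sym m p : energy m p = energy p m.
Proof.
rewrite /energy /potential.
rewrite -[RHS](@fubini_tonelli _ _ _ _ _ m p (EFin \o k)).
- by apply: eq_integral => x _; apply: eq_integral => y _; rewrite /= k_sym.
- exact/measurable_EFinP.
- by move=> z; rewrite lee_fin.
Qed.

(** A weight given as a difference [p - n] has potential [1]; integrating this
    against [m] computes the mass of [m] from energies. *)
Let mass_energy m p n : (forall y, potential p y - potential n y = 1) ->
  m setT = energy m p - energy m n.
Proof.
move=> pn1; rewrite -(integralB measurableT) //; try exact: integrable_potential.
under eq_integral do rewrite /= pn1.
by rewrite integral_cst// mul1e.
Qed.

(** Each mass is expressed by [mass_energy] through the other weight; both
    expressions expand into the same four energies of Jordan parts, because the
    energy is symmetric.  The bound on [k] makes these energies finite, so that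
    they can be rearranged. *)
Lemma weight_mass_unique (nu nu' : {charge set T -> \bar R}) :
  (forall y, charge_integral nu (fun x => (k (x, y))%:E) = 1) ->
  (forall y, charge_integral nu' (fun x => (k (x, y))%:E) = 1) ->
  nu setT = nu' setT.
Proof.
pose p : {finite_measure set T -> \bar R} := jordan_pos (hahn_pos_neg nu).
pose n : {finite_measure set T -> \bar R} := jordan_neg (hahn_pos_neg nu).
pose p' : {finite_measure set T -> \bar R} := jordan_pos (hahn_pos_neg nu').
pose n' : {finite_measure set T -> \bar R} := jordan_neg (hahn_pos_neg nu').
move=> nu1 nu1'.
have {}nu1 y : potential p y - potential n y = 1 by exact: nu1.
have {}nu1' y : potential p' y - potential n' y = 1 by exact: nu1'.
have -> : nu setT = p setT - n setT by exact: jordan_decompB.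
have -> : nu' setT = p' setT - n' setT by exact: jordan_decompB.
rewrite (mass_energy p nu1') (mass_energy n nu1').
rewrite (mass_energy p' nu1) (mass_energy n' nu1).
rewrite (energy_sym p' p) (energy_sym p' n) (energy_sym n' p) (energy_sym n' n).
rewrite -(fineK (energy_fin p p')) -(fineK (energy_fin p n')).
rewrite -(fineK (energy_fin n p')) -(fineK (energy_fin n n')).
by rewrite -!EFinN -!EFinD; congr EFin; ring.
Qed.

End kernel_weights.

(** * Invariant measures *)

Section invariant.
Context {R : realType} {X : pmetricType R}.
Variable mu : {measure set (borel X) -> \bar R}.

(** An isometry [g] of the group sending [y] to [z] carries the radial function
    around [y] to the one around [z] and preserves [mu]. *)
Lemma invariant_radial_integral (f : R -> \bar R) (y z : X) :
  invariant_measure mu -> measurable_fun setT f -> (forall r, 0 <= f r) ->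
  \int[mu]_x f (mdist (x : X) y) = \int[mu]_x f (mdist (x : X) z).
Proof.
move=> [G [[isoG _ _ _] trG invG]] mf f0.
have [g Gg <-] := trG y z.
have mg := measurable_isometry (isoG g Gg).
have -> : \int[mu]_x f (mdist (x : X) (g y)) =
    \int[pushforward mu (g : borel X -> borel X)]_x f (mdist (x : X) (g y)).
  by apply: eq_measure_integral => A mA _; exact/esym/invG.
rewrite [RHS](ge0_integral_pushforward mg)//.
  by rewrite preimage_setT; apply: eq_integral => x _ /=; rewrite isoG.
exact: (measurableT_comp mf (measurable_mdist_left (g y))).
Qed.

End invariant.

Theorem theorem1 (R : realType) (X : pmetricType R)
    (mu : {measure set (borel X) -> \bar R})
    (Xhom : homogeneous X) (mu_inv : invariant_measure mu) :
  let I (y : X) := \int[mu]_x (expR (- mdist (x : X) y))%:E in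
  (forall y z : X, I y = I z) /\
  (forall y : X, I y != 0 -> I y < +oo ->
     (exists nu : {measure set (borel X) -> \bar R},
        (forall A, nu A = mu A / I y) /\
        (forall z : X, \int[nu]_x (expR (- mdist (x : X) z))%:E = 1)) /\
     (mu setT < +oo ->
        [/\ exists nu : {charge set (borel X) -> \bar R},
              (forall A, nu A = mu A / I y) /\ weight_measure nu,
            is_magnitude X (mu setT / I y) &
            separable X -> magnitude X = mu setT / I y])).
Proof.
move=> I.
have I_const y z : I y = I z.
  apply: (@invariant_radial_integral _ _ _ (fun r => (expR (- r))%:E)) => //.
  by apply/measurable_EFinP; exact: measurableT_comp.
split=> // y I_neq0 I_lty.
have I_fin : I y \is a fin_num.
  by rewrite ge0_fin_numE//; apply: integral_ge0 => x _; rewrite lee_fin expR_ge0.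
have I_inv : (I y)^-1 = ((fine (I y))^-1)%:E.
  by rewrite -{1}(fineK I_fin) inver fine_eq0// (negbTE I_neq0).
have c_ge0 : (0 <= (fine (I y))^-1)%R.
  rewrite invr_ge0 fine_ge0//.
  by apply: integral_ge0 => x _; rewrite lee_fin expR_ge0.
(* Scaling multiplies every value of [mu] on the left by the real number
   [(fine (I y))^-1], so [nu A] is [mu A / I y] on all sets, measurable or not. *)
pose nu : {measure set (borel X) -> \bar R} := mscale (NngNum c_ge0) mu.
have nuE A : nu A = mu A / I y by rewrite I_inv muleC.
have nu1 z : \int[nu]_x (expR (- mdist (x : X) z))%:E = 1.
  rewrite ge0_integral_mscale//.
  - rewrite -/(I z) (I_const z y) -[RHS](divee I_fin I_neq0) muleC.
    by rewrite I_inv.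
  - apply/measurable_EFinP; do 2 apply: measurableT_comp => //.
    exact: measurable_mdist_left.
split; first by exists nu.
move=> mu_lty.
have [rho rhoE] : exists rho : {charge set (borel X) -> \bar R}, forall A, rho A = nu A.
  by apply: finite_measure_charge; rewrite nuE I_inv muleC lte_mul_pinfty.
have rho_weight : weight_measure rho.
  by move=> z; rewrite (charge_integral_measure (mu := nu))// => A _; exact: rhoE.
have mag : is_magnitude X (mu setT / I y) by exists rho => //; rewrite rhoE nuE.
split=> //; first by exists rho; split=> // A; rewrite rhoE.
move=> sepX; apply: xget_unique => // m [rho' rho'_weight ->].
rewrite -nuE -rhoE.
apply: (@weight_mass_unique _ (borel X) R
  (fun z => expR (- mdist (z.1 : X) z.2)) 1%R) => //=.
- do 2 apply: measurableT_comp => //.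
  exact: measurable_mdist.
- by move=> z; rewrite expR_le1 oppr_le0 mdist_ge0.
- by move=> x z; rewrite metric_sym.
Qed.
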